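(* Let $\psi$ be a bounded holomorphic function on $\mathbb D$ with $\|\psi\|_\infty\le1$ and $\psi\not\equiv1$. The following are equivalent: (1) $\operatorname{Re}\frac{\psi(z)+1}{\psi(z)-1}\ge\operatorname{Re}\frac{z+1}{z-1}$ for all $z\in\mathbb D$; (2) $\frac{|1-\psi(z)|^2}{1-|\psi(z)|^2}\ge\frac{|1-z|^2}{1-|z|^2}$ for all $z\in\mathbb D$ (the left side being interpreted as $+\infty$ when $|\psi(z)|=1$); (3) $\psi(z)=\alpha\frac{z-\beta}{1-\bar\beta z}$ for $z\in\mathbb D$, where $\alpha=\frac{1+b+ia}{1+b-ia}$ and $\beta=\frac{1-b+ia}{1+b+ia}$ for some $a\in\mathbb R$ and $0\le b\le1$; (4) $\psi$ is either a constant $e^{i\theta}$ with $\theta\in(0,2\pi)$, or an automorphism of $\mathbb D$ such that $\psi^{-1}$ maps every Stolz type region $\{z\in\mathbb D:|1-z|^2<M(1-|z|^2)\}$, $M>0$, into itself.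
   Context: $\mathbb D$ is the open unit disc and $\|\psi\|_\infty=\sup_{z\in\mathbb D}|\psi(z)|$. *)

(* Defs.v *)
From Stdlib Require Import Reals.
From Coquelicot Require Import Coquelicot.
Open Scope R_scope.

Definition in_disc (z : C) : Prop := Cmod z < 1.

Definition holomorphic_on_disc (f : C -> C) : Prop :=
  forall z : C, in_disc z -> ex_derive (K:=C_AbsRing) (V:=C_NormedModule) f z.

Definition sup_norm_le1 (f : C -> C) : Prop :=
  forall z : C, in_disc z -> Cmod (f z) <= 1.

(* f is an automorphism of D: f is holomorphic on D and maps D bijectively onto D
   (the inverse of a holomorphic bijection is automatically holomorphic). *)
Definition disc_automorphism (f : C -> C) : Prop :=
  holomorphic_on_disc f /\
  (forall z, in_disc z -> in_disc (f z)) /\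
  (forall w, in_disc w -> exists z, in_disc z /\ f z = w /\
                            forall z', in_disc z' -> f z' = w -> z' = z).

Definition stolz (M : R) (z : C) : Prop :=
  in_disc z /\ (Cmod (RtoC 1 - z)%C) ^ 2 < M * (1 - (Cmod z) ^ 2).

(* Main.v *)
Require Import Defs.
From Stdlib Require Import Reals Lra Classical.
From Coquelicot Require Import Coquelicot.
Open Scope R_scope.

(* Let G(z) = (1 + z)/(1 - z), so that Re G is the Poisson kernel at 1, and let
   f be psi followed by G, read on the right half-plane w = G(z). Conditions (1)
   and (2) both say 0 <= Re f(w) <= Re w, and (3) says f(w) = b w - i a.
   Schwarz-Pick applied to f and to w - f gives
   |f'(w)| <= Re f(w) / Re w and |1 - f'(w)| <= 1 - Re f(w) / Re w.
   These two discs touch at one point, so f'(w) = Re f(w) / Re w is real; hence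
   Re f(w) / Re w has zero gradient, f' is constant and f is affine.
   Schwarz-Pick itself is Caratheodory's inequality |F'(0)| <= 2 Re F(0), the
   positivity of the circle mean of Re F against 1 + cos(t - t0); circle means
   are independent of the radius by Goursat's bisection argument in
   logarithmic coordinates. *)

(** * Complex differentiation *)

(* Unlike the [C_NormedModule] of [holomorphic_on_disc], the codomain
   [AbsRing_NormedModule C_AbsRing] supports Coquelicot's product and chain rules. *)
Definition cderiv (f : C -> C) (z l : C) : Prop :=
  is_derive (K := C_AbsRing) (V := AbsRing_NormedModule C_AbsRing) f z l.

(** Both structures on the codomain have the same norm and operations, so the remainder estimate
    carries over verbatim; only the linearity component is rebuilt. *)
Lemma ex_derive_cderiv (f : C -> C) (z : C) :
  ex_derive (K:=C_AbsRing) (V:=C_NormedModule) f z ->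
  exists l : C, cderiv f z l.
Proof.
intros [l [_ Hl]]; exists l.
split; [exact (is_linear_scal_l (K := C_AbsRing) (V := AbsRing_NormedModule C_AbsRing) l) | exact Hl].
Qed.

Lemma cderivP (f : C -> C) (z l : C) :
  cderiv f z l <->
  forall eps, 0 < eps -> exists d, 0 < d /\ forall y : C, Cmod (y - z) < d ->
    Cmod (f y - f z - (y - z) * l) <= eps * Cmod (y - z).
Proof.
split.
- intros [_ H] eps Heps.
  destruct (H z (fun P HP => HP) (mkposreal _ Heps)) as [d Hd].
  exists d; split; [apply cond_pos|exact Hd].
- intros H; split.
  + exact (is_linear_scal_l (K := C_AbsRing) (V := AbsRing_NormedModule C_AbsRing) l).
  + intros x Hx.
    apply (is_filter_lim_locally_unique (V := AbsRing_NormedModule C_AbsRing)) in Hx.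
    subst x. intros eps.
    destruct (H eps (cond_pos eps)) as [d [Hd Hy]].
    exists (mkposreal d Hd). exact Hy.
Qed.

Lemma cderiv_eq (f : C -> C) (z l l' : C) : l = l' -> cderiv f z l -> cderiv f z l'.
Proof. now intros ->. Qed.

Lemma cderiv_const (c z : C) : cderiv (fun _ => c) z 0%C.
Proof. exact (is_derive_const (K := C_AbsRing) (V := AbsRing_NormedModule C_AbsRing) c z). Qed.

Lemma cderiv_id (z : C) : cderiv (fun t => t) z 1%C.
Proof. exact (is_derive_id (K := C_AbsRing) z). Qed.

Lemma cderiv_plus (f g : C -> C) (z l m : C) :
  cderiv f z l -> cderiv g z m -> cderiv (fun t => f t + g t)%C z (l + m)%C.
Proof. exact (is_derive_plus (K := C_AbsRing) (V := AbsRing_NormedModule C_AbsRing) f g z l m). Qed.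

Lemma cderiv_minus (f g : C -> C) (z l m : C) :
  cderiv f z l -> cderiv g z m -> cderiv (fun t => f t - g t)%C z (l - m)%C.
Proof. exact (is_derive_minus (K := C_AbsRing) (V := AbsRing_NormedModule C_AbsRing) f g z l m). Qed.

Lemma cderiv_mult (f g : C -> C) (z l m : C) :
  cderiv f z l -> cderiv g z m -> cderiv (fun t => f t * g t)%C z (l * g z + f z * m)%C.
Proof.
intros Hf Hg.
exact (is_derive_mult (K := C_AbsRing) f g z l m Hf Hg Cmult_comm).
Qed.

Lemma cderiv_comp (f g : C -> C) (z l m : C) :
  cderiv f (g z) l -> cderiv g z m -> cderiv (fun t => f (g t)) z (m * l)%C.
Proof. exact (is_derive_comp (K := C_AbsRing) (V := AbsRing_NormedModule C_AbsRing) f g z l m). Qed.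

Lemma Cmod_sub_lt_neq (y z : C) : Cmod (y - z) < Cmod z -> y <> 0%C.
Proof.
intros H ->. replace (0 - z)%C with (- z)%C in H by ring. rewrite Cmod_opp in H. lra.
Qed.

Lemma cderiv_inv (z : C) : z <> 0%C -> cderiv Cinv z (- / (z * z))%C.
Proof.
intros Hz. apply cderivP. intros eps Heps.
assert (Hm : 0 < Cmod z) by now apply Cmod_gt_0.
(* The remainder is (y - z)^2 / (z^2 y). The first bound keeps |y| >= |z| / 2, and the second then
   makes |y - z| at most eps |z^2 y|. *)
exists (Rmin (Cmod z / 2) (eps * Cmod z ^ 3 / 2)). split.
{ apply Rmin_glb_lt; [lra|]. apply Rdiv_lt_0_compat; [|lra].
  apply Rmult_lt_0_compat; [lra|]. now apply pow_lt. }
intros y Hy.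
assert (H1 : Cmod (y - z) < Cmod z / 2) by (eapply Rlt_le_trans; [exact Hy|apply Rmin_l]).
assert (H2 : Cmod (y - z) < eps * Cmod z ^ 3 / 2) by (eapply Rlt_le_trans; [exact Hy|apply Rmin_r]).
assert (Hy0 : y <> 0%C) by (apply (Cmod_sub_lt_neq y z); lra).
assert (Hym : Cmod z / 2 <= Cmod y).
{ generalize (Cmod_triangle y (z - y)). replace (y + (z - y))%C with z by ring.
  replace (z - y)%C with (- (y - z))%C by ring. rewrite Cmod_opp. lra. }
replace (/ y - / z - (y - z) * - / (z * z))%C
  with ((y - z) * ((y - z) / (z * z * y)))%C by (field; auto).
rewrite Cmod_mult, Rmult_comm.
apply Rmult_le_compat_r; [apply Cmod_ge_0|].
rewrite Cmod_div, !Cmod_mult by (repeat apply Cmult_neq_0; auto).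
apply Rle_div_l.
{ apply Rmult_lt_0_compat; [now apply Rmult_lt_0_compat|lra]. }
apply Rle_trans with (eps * (Cmod z * Cmod z * (Cmod z / 2))).
- replace (eps * (Cmod z * Cmod z * (Cmod z / 2))) with (eps * Cmod z ^ 3 / 2) by field. lra.
- apply Rmult_le_compat_l; [lra|]. apply Rmult_le_compat_l; [nra|lra].
Qed.

Lemma cderiv_div (f g : C -> C) (z l m : C) :
  g z <> 0%C -> cderiv f z l -> cderiv g z m ->
  cderiv (fun t => f t / g t)%C z ((l * g z - f z * m) / (g z * g z))%C.
Proof.
intros Hg Hf Hg'.
eapply cderiv_eq; [|apply cderiv_mult; [exact Hf|]].
2: exact (cderiv_comp Cinv g z _ _ (cderiv_inv _ Hg) Hg').
cbv beta. field; auto.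
Qed.

Lemma cderiv_re (f : C -> C) (x y : R) (l : C) :
  cderiv f (x, y) l ->
  differentiable_pt_lim (fun u v => Re (f (u, v))) x y (Re l) (- Im l).
Proof.
intros Hf eps.
(* [differentiable_pt_lim] uses the sup norm; the modulus is at most sqrt 2 <= 2 times larger, hence
   the halves of eps and d. *)
destruct (proj1 (cderivP _ _ _) Hf (eps / 2) (is_pos_div_2 eps)) as [d [Hd H]].
assert (Hd2 : 0 < d / 2) by lra.
exists (mkposreal _ Hd2). simpl. intros u v Hu Hv.
assert (Hs : Cmod ((u, v) - (x, y))%C <= 2 * Rmax (Rabs (u - x)) (Rabs (v - y))).
{ eapply Rle_trans; [apply Cmod_2Rmax|]. simpl.
  apply Rmult_le_compat_r.
  - eapply Rle_trans; [apply Rabs_pos|apply Rmax_l].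
  - apply Rle_trans with (sqrt (2 * 2)).
    + apply sqrt_le_1; lra.
    + rewrite sqrt_square; lra. }
assert (Hm : Rmax (Rabs (u - x)) (Rabs (v - y)) < d / 2) by now apply Rmax_lub_lt.
eapply Rle_trans; [|eapply Rle_trans; [apply (H (u, v)); lra|]].
- eapply Rle_trans; [|apply re_le_Cmod]. apply Req_le. f_equal.
  destruct l as [a b]. simpl. unfold Re, Im. simpl. ring.
- apply Rle_trans with (eps / 2 * (2 * Rmax (Rabs (u - x)) (Rabs (v - y)))).
  + apply Rmult_le_compat_l; [generalize (cond_pos eps); lra|exact Hs].
  + lra.
Qed.

(** Im f is the real part of -i f, so this reduces to [cderiv_re]. *)
Lemma cderiv_im (f : C -> C) (x y : R) (l : C) :
  cderiv f (x, y) l ->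
  differentiable_pt_lim (fun u v => Im (f (u, v))) x y (Im l) (Re l).
Proof.
intros Hf.
assert (H : cderiv (fun t => - Ci * f t)%C (x, y) (- Ci * l)%C).
{ eapply cderiv_eq; [|exact (cderiv_mult _ _ _ _ _ (cderiv_const (- Ci)%C (x, y)) Hf)]. cbv beta. ring. }
apply cderiv_re in H.
replace (Im l) with (Re (- Ci * l)) by (unfold Re, Im; simpl; ring).
replace (Re l) with (- Im (- Ci * l)) by (unfold Re, Im; simpl; ring).
eapply differentiable_pt_lim_ext; [|exact H].
exists (mkposreal 1 Rlt_0_1). intros u v _ _. unfold Re, Im; simpl; ring.
Qed.

(** * Goursat's lemma *)

Lemma differentiable_slice_x (f : R -> R -> R) x y lx ly :
  differentiable_pt_lim f x y lx ly -> continuous (fun t => f t y) x.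
Proof.
intros H. apply continuity_pt_filterlim.
apply derivable_continuous_pt.
exists (lx * 1 + ly * 0).
apply (derivable_pt_lim_comp_2d f (fun t => t) (fun _ => y)).
- exact H.
- apply derivable_pt_lim_id.
- apply derivable_pt_lim_const.
Qed.

Lemma differentiable_slice_y (f : R -> R -> R) x y lx ly :
  differentiable_pt_lim f x y lx ly -> continuous (fun t => f x t) y.
Proof.
intros H. apply continuity_pt_filterlim.
apply derivable_continuous_pt.
exists (lx * 0 + ly * 1).
apply (derivable_pt_lim_comp_2d f (fun _ => x) (fun t => t)).
- exact H.
- apply derivable_pt_lim_const.
- apply derivable_pt_lim_id.
Qed.

Lemma RInt_near_const (f : R -> R) u h c e :
  0 <= h -> ex_RInt f u (u + h) -> (forall t, u <= t <= u + h -> Rabs (f t - c) <= e) ->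
  Rabs (RInt f u (u + h) - c * h) <= e * h.
Proof.
intros Hh Hf He.
replace (RInt f u (u + h) - c * h) with (RInt (fun t => minus (f t) c) u (u + h)).
- rewrite (Rmult_comm e). replace (h * e) with ((u + h - u) * e) by ring.
  apply abs_RInt_le_const; [lra| |exact He].
  apply (ex_RInt_minus (V := R_NormedModule)); [exact Hf|apply ex_RInt_const].
- rewrite (RInt_minus (V := R_CompleteNormedModule)); [|exact Hf|apply ex_RInt_const].
  rewrite RInt_const. unfold minus, plus, opp, scal; simpl. unfold mult; simpl. ring.
Qed.

Lemma Rabs_sum4_gt p q r s t : 4 * t < Rabs (p + q + (r + s)) ->
  t < Rabs p \/ t < Rabs q \/ t < Rabs r \/ t < Rabs s.
Proof.
intros H.
destruct (Rlt_le_dec t (Rabs p)); [tauto|]. destruct (Rlt_le_dec t (Rabs q)); [tauto|].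
destruct (Rlt_le_dec t (Rabs r)); [tauto|]. right; right; right.
assert (H1 := Rabs_triang (p + q) (r + s)).
assert (H2 := Rabs_triang p q). assert (H3 := Rabs_triang r s). lra.
Qed.

Lemma is_lim_seq_div_2pow c : is_lim_seq (fun n => c / 2 ^ n) 0.
Proof.
replace (Finite 0) with (Rbar_mult c 0) by (simpl; f_equal; ring).
apply is_lim_seq_ext with (fun n => c * (/ 2) ^ n).
- intros n. rewrite pow_inv. reflexivity.
- apply is_lim_seq_scal_l. apply is_lim_seq_geom. rewrite Rabs_pos_eq; lra.
Qed.

(** The interval [u n, u n + c / 2^n] is replaced at each step by its left or right half. The
    endpoint sequences are adjacent, and their common limit lies in every interval. *)
Lemma nested_point (u : nat -> R) c :
  0 < c -> (forall n, u (S n) = u n \/ u (S n) = u n + c / 2 ^ S n) ->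
  exists x, forall n, u n <= x <= u n + c / 2 ^ n.
Proof.
intros Hc Hu.
assert (Hp : forall n, 0 < c / 2 ^ S n).
{ intros n. apply Rdiv_lt_0_compat; [lra|apply pow_lt; lra]. }
assert (Hd : forall n, c / 2 ^ n = c / 2 ^ S n + c / 2 ^ S n).
{ intros n. simpl. field. apply pow_nonzero; lra. }
destruct (ex_lim_seq_adj u (fun n => u n + c / 2 ^ n)) as [[l Hl] [[m Hm] Hlm]].
- intros n. specialize (Hp n). destruct (Hu n) as [-> | ->]; lra.
- intros n. specialize (Hp n). specialize (Hd n). destruct (Hu n) as [-> | ->]; lra.
- apply is_lim_seq_ext with (fun n => c / 2 ^ n); [intros; ring|apply is_lim_seq_div_2pow].
- exists l. intros n. split.
  + apply is_lim_seq_incr_compare; [exact Hl|].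
    intros k. specialize (Hp k). destruct (Hu k) as [-> | ->]; lra.
  + rewrite (is_lim_seq_unique _ _ Hl), (is_lim_seq_unique _ _ Hm) in Hlm.
    injection Hlm as ->.
    apply (is_lim_seq_decr_compare (fun n => u n + c / 2 ^ n)); [exact Hm|].
    intros k. specialize (Hp k). specialize (Hd k). destruct (Hu k) as [-> | ->]; lra.
Qed.

Section Goursat.

Variables (A B : R -> R -> R) (x0 y0 a b : R).
Hypotheses (Ha : 0 < a) (Hb : 0 < b).
(** The form A dx + B dy is closed at each point: the shared [c] is both the y-derivative of A and
    the x-derivative of B. The partial derivatives may be discontinuous, which is why bisection is
    used rather than Green's formula. *)
Hypothesis closed_form : forall x y, x0 <= x <= x0 + a -> y0 <= y <= y0 + b ->
  exists ax c by_, differentiable_pt_lim A x y ax c /\ differentiable_pt_lim B x y c by_.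

(** The counterclockwise integral of A dx + B dy around a rectangle with lower left corner (x,
    y). *)
Definition circulation (x y h k : R) : R :=
  RInt (fun t => A t y) x (x + h) - RInt (fun t => A t (y + k)) x (x + h)
  + (RInt (B (x + h)) y (y + k) - RInt (B x) y (y + k)).

Lemma ex_RInt_A x h y : x0 <= x -> 0 <= h -> x + h <= x0 + a -> y0 <= y <= y0 + b ->
  ex_RInt (fun t => A t y) x (x + h).
Proof.
intros. apply (ex_RInt_continuous (V := R_CompleteNormedModule)). intros z. rewrite Rmin_left, Rmax_right by lra.
intros Hz. destruct (closed_form z y) as [? [? [? [HA _]]]]; try lra.
exact (differentiable_slice_x _ _ _ _ _ HA).
Qed.

Lemma ex_RInt_B x y k : x0 <= x <= x0 + a -> y0 <= y -> 0 <= k -> y + k <= y0 + b ->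
  ex_RInt (B x) y (y + k).
Proof.
intros. apply (ex_RInt_continuous (V := R_CompleteNormedModule)). intros z. rewrite Rmin_left, Rmax_right by lra.
intros Hz. destruct (closed_form x z) as [? [? [? [_ HB]]]]; try lra.
exact (differentiable_slice_y _ _ _ _ _ HB).
Qed.

(** Each inner edge is traversed twice, in opposite directions, and cancels. *)
Lemma circulation_split x y h k :
  x0 <= x -> y0 <= y -> 0 <= h -> 0 <= k -> x + h + h <= x0 + a -> y + k + k <= y0 + b ->
  circulation x y (h + h) (k + k) =
  circulation x y h k + circulation (x + h) y h k
  + (circulation x (y + k) h k + circulation (x + h) (y + k) h k).
Proof.
intros. unfold circulation. rewrite <- !Rplus_assoc.
assert (EA : forall t, y0 <= t <= y0 + b ->
  RInt (fun s => A s t) x (x + h + h) =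
  RInt (fun s => A s t) x (x + h) + RInt (fun s => A s t) (x + h) (x + h + h)).
{ intros t Ht. symmetry. apply (RInt_Chasles (V := R_CompleteNormedModule)); apply ex_RInt_A; lra. }
assert (EB : forall t, x0 <= t <= x0 + a ->
  RInt (B t) y (y + k + k) =
  RInt (B t) y (y + k) + RInt (B t) (y + k) (y + k + k)).
{ intros t Ht. symmetry. apply (RInt_Chasles (V := R_CompleteNormedModule)); apply ex_RInt_B; lra. }
rewrite !EA, !EB by lra. ring.
Qed.

(* On a small rectangle around a point, the affine part of (A, B) has no circulation. *)
Lemma circulation_small x y e : x0 <= x <= x0 + a -> y0 <= y <= y0 + b -> 0 < e ->
  exists d, 0 < d /\ forall u v h k,
    x0 <= u -> y0 <= v -> 0 <= h -> 0 <= k -> u + h <= x0 + a -> v + k <= y0 + b ->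
    u <= x <= u + h -> v <= y <= v + k -> h + k < d ->
    Rabs (circulation u v h k) <= e * (h + k) ^ 2.
Proof.
intros Hx Hy He.
destruct (closed_form x y Hx Hy) as [ax [c [by_ [HA HB]]]].
assert (He2 : 0 < e / 2) by lra.
destruct (HA (mkposreal _ He2)) as [dA HdA].
destruct (HB (mkposreal _ He2)) as [dB HdB].
simpl in HdA, HdB.
exists (Rmin dA dB). split; [apply Rmin_glb_lt; apply cond_pos|].
intros u v h k Hu Hv Hh Hk Huh Hvk Hxu Hyv Hd.
assert (HdA' : h + k < dA) by (eapply Rlt_le_trans; [exact Hd|apply Rmin_l]).
assert (HdB' : h + k < dB) by (eapply Rlt_le_trans; [exact Hd|apply Rmin_r]).
assert (Hnear : forall s t, u <= s <= u + h -> v <= t <= v + k ->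
  Rabs (s - x) <= h /\ Rabs (t - y) <= k).
{ intros s t Hs Ht. split; apply Rabs_le; lra. }
assert (EA : forall s t, u <= s <= u + h -> v <= t <= v + k ->
  Rabs (A s t - A x y - (ax * (s - x) + c * (t - y))) <= e / 2 * (h + k)).
{ intros s t Hs Ht. destruct (Hnear s t Hs Ht).
  eapply Rle_trans; [apply HdA; lra|]. apply Rmult_le_compat_l; [lra|].
  apply Rmax_lub; lra. }
assert (EB : forall s t, u <= s <= u + h -> v <= t <= v + k ->
  Rabs (B s t - B x y - (c * (s - x) + by_ * (t - y))) <= e / 2 * (h + k)).
{ intros s t Hs Ht. destruct (Hnear s t Hs Ht).
  eapply Rle_trans; [apply HdB; lra|]. apply Rmult_le_compat_l; [lra|].
  apply Rmax_lub; lra. }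
(* Opposite edges are paired. The affine part of A contributes -c k h, that of B contributes c h k,
   and these cancel. Two remainders of size e / 2 * (h + k) survive in each integrand. *)
assert (I1 : Rabs (RInt (fun t => minus (A t v) (A t (v + k))) u (u + h) - (- (c * k)) * h)
  <= e * (h + k) * h).
{ apply RInt_near_const; [lra| |].
  - apply (ex_RInt_minus (V := R_NormedModule)); apply ex_RInt_A; lra.
  - intros t Ht. unfold minus, plus, opp; simpl.
    assert (E1 := EA t v Ht ltac:(lra)). assert (E2 := EA t (v + k) Ht ltac:(lra)).
    apply Rabs_le_between in E1. apply Rabs_le_between in E2. apply Rabs_le. lra. }
assert (I2 : Rabs (RInt (fun t => minus (B (u + h) t) (B u t)) v (v + k) - (c * h) * k)
  <= e * (h + k) * k).
{ apply RInt_near_const; [lra| |].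
  - apply (ex_RInt_minus (V := R_NormedModule)); apply ex_RInt_B; lra.
  - intros t Ht. unfold minus, plus, opp; simpl.
    assert (E1 := EB u t ltac:(lra) Ht). assert (E2 := EB (u + h) t ltac:(lra) Ht).
    apply Rabs_le_between in E1. apply Rabs_le_between in E2. apply Rabs_le. lra. }
rewrite (RInt_minus (V := R_CompleteNormedModule)) in I1 by (apply ex_RInt_A; lra).
rewrite (RInt_minus (V := R_CompleteNormedModule)) in I2 by (apply ex_RInt_B; lra).
unfold minus, plus, opp in I1, I2; simpl in I1, I2.
apply Rabs_le_between in I1. apply Rabs_le_between in I2.
unfold circulation. apply Rabs_le.
nra.
Qed.

(** The last quarter is a default taken without a test; [Rabs_sum4_gt] shows that it is heavy when
    the other three are not. *)
Definition heavy_quarter (t h k : R) (p : R * R) : R * R :=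
  let (x, y) := p in
  if Rlt_dec t (Rabs (circulation x y h k)) then (x, y)
  else if Rlt_dec t (Rabs (circulation (x + h) y h k)) then (x + h, y)
  else if Rlt_dec t (Rabs (circulation x (y + k) h k)) then (x, y + k)
  else (x + h, y + k).

Fixpoint corner (e : R) (n : nat) : R * R :=
  match n with
  | O => (x0, y0)
  | S m => heavy_quarter (e / 4 ^ S m) (a / 2 ^ S m) (b / 2 ^ S m) (corner e m)
  end.

Lemma heavy_quarter_cases t h k x y :
  let q := heavy_quarter t h k (x, y) in
  (fst q = x \/ fst q = x + h) /\ (snd q = y \/ snd q = y + k).
Proof.
unfold heavy_quarter. repeat destruct Rlt_dec; simpl; tauto.
Qed.

(** Invariant of the bisection: some quarter always carries more than a fourth of the current lower
    bound. *)
Lemma corner_spec e n : e < Rabs (circulation x0 y0 a b) ->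
  let x := fst (corner e n) in let y := snd (corner e n) in
  (x0 <= x /\ x + a / 2 ^ n <= x0 + a) /\ (y0 <= y /\ y + b / 2 ^ n <= y0 + b) /\
  e / 4 ^ n < Rabs (circulation x y (a / 2 ^ n) (b / 2 ^ n)).
Proof.
intros He. induction n as [|n IH].
- simpl. rewrite !Rdiv_1_r. lra.
- cbn [corner]. destruct (corner e n) as [x y]. cbn [fst snd] in IH.
  assert (H2 : 0 < 2 ^ n) by (apply pow_lt; lra).
  set (h := a / 2 ^ S n). set (k := b / 2 ^ S n).
  assert (Eh : a / 2 ^ n = h + h) by (unfold h; simpl; field; lra).
  assert (Ek : b / 2 ^ n = k + k) by (unfold k; simpl; field; lra).
  assert (Hh : 0 < h) by (apply Rdiv_lt_0_compat; [lra|apply pow_lt; lra]).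
  assert (Hk : 0 < k) by (apply Rdiv_lt_0_compat; [lra|apply pow_lt; lra]).
  assert (Ee : e / 4 ^ n = 4 * (e / 4 ^ S n)).
  { simpl. field. apply pow_nonzero; lra. }
  rewrite Eh, Ek, Ee in IH. destruct IH as [Ix [Iy Ic]].
  cbv zeta.
  assert (HC := heavy_quarter_cases (e / 4 ^ S n) h k x y). cbv zeta in HC.
  split; [destruct HC as [[-> | ->] _]; lra|].
  split; [destruct HC as [_ [-> | ->]]; lra|].
  rewrite circulation_split in Ic by lra. apply Rabs_sum4_gt in Ic.
  unfold heavy_quarter.
  repeat destruct Rlt_dec; simpl fst; simpl snd; try assumption. tauto.
Qed.

Lemma circulation_eq0 : circulation x0 y0 a b = 0.
Proof.
apply NNPP. intros Hne. apply Rabs_pos_lt in Hne.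
(* Halving gives the strict inequality that starts the bisection. *)
set (e := Rabs (circulation x0 y0 a b) / 2).
assert (He : e < Rabs (circulation x0 y0 a b)) by (unfold e; lra).
assert (He0 : 0 < e) by (unfold e; lra).
assert (HS := fun n => corner_spec e n He). cbv zeta in HS.
assert (HQ : forall n, (fst (corner e (S n)) = fst (corner e n) \/
    fst (corner e (S n)) = fst (corner e n) + a / 2 ^ S n) /\
    (snd (corner e (S n)) = snd (corner e n) \/
    snd (corner e (S n)) = snd (corner e n) + b / 2 ^ S n)).
{ intros n. cbn [corner]. destruct (corner e n) as [x y]. apply heavy_quarter_cases. }
destruct (nested_point (fun n => fst (corner e n)) a Ha (fun n => proj1 (HQ n))) as [x Hx].
destruct (nested_point (fun n => snd (corner e n)) b Hb (fun n => proj2 (HQ n))) as [y Hy].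
assert (Hab : 0 < (a + b) ^ 2) by (apply pow_lt; lra).
(* With this tolerance the upper bound at stage n is exactly e / 4^n, contradicting the lower bound
   of [corner_spec]. *)
destruct (circulation_small x y (e / (a + b) ^ 2)) as [d [Hd Hsmall]].
- specialize (Hx O). simpl in Hx. rewrite Rdiv_1_r in Hx. lra.
- specialize (Hy O). simpl in Hy. rewrite Rdiv_1_r in Hy. lra.
- now apply Rdiv_lt_0_compat.
- destruct (is_lim_seq_div_2pow (a + b) (fun t => t < d)) as [n Hn].
  { exists (mkposreal d Hd). intros t Ht.
    unfold ball in Ht; simpl in Ht. unfold AbsRing_ball, abs, minus, plus, opp in Ht; simpl in Ht.
    apply Rabs_lt_between in Ht. lra. }
  specialize (Hn n (le_n n)).
  assert (H2 : 0 < 2 ^ n) by (apply pow_lt; lra).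
  destruct (HS n) as [[S1 S2] [[S3 S4] S5]].
  assert (Hs : a / 2 ^ n + b / 2 ^ n = (a + b) / 2 ^ n) by (field; lra).
  assert (Pa : 0 < a / 2 ^ n) by now apply Rdiv_lt_0_compat.
  assert (Pb : 0 < b / 2 ^ n) by now apply Rdiv_lt_0_compat.
  assert (HF := Hsmall _ _ _ _ S1 S3 (Rlt_le _ _ Pa) (Rlt_le _ _ Pb) S2 S4 (Hx n) (Hy n)
    ltac:(lra)).
  rewrite Hs in HF.
  replace (e / (a + b) ^ 2 * ((a + b) / 2 ^ n) ^ 2) with (e / 4 ^ n) in HF; [lra|].
  replace 4 with (2 * 2) by ring. rewrite Rpow_mult_distr. field. lra.
Qed.

End Goursat.

(** * Circle means *)

(** The exponential of x + i y: circles about the origin become vertical segments. *)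
Definition cexp (x y : R) : C := (exp x * cos y, exp x * sin y).

Lemma Cmod_cexp x y : Cmod (cexp x y) = exp x.
Proof.
unfold Cmod, cexp; cbn [fst snd].
replace ((exp x * cos y) ^ 2 + (exp x * sin y) ^ 2)
  with (exp x * exp x * ((sin y)² + (cos y)²)) by (unfold Rsqr; ring).
rewrite sin2_cos2, Rmult_1_r. apply sqrt_square. left; apply exp_pos.
Qed.

Lemma differentiable_pt_lim_mult x y : differentiable_pt_lim Rmult x y y x.
Proof.
intros eps. exists eps. intros u v Hu Hv.
replace (u * v - x * y - (y * (u - x) + x * (v - y))) with ((u - x) * (v - y)) by ring.
rewrite Rabs_mult. apply Rmult_le_compat; try apply Rabs_pos; [lra|apply Rmax_r].
Qed.

Lemma differentiable_pt_lim_exp_mult (f : R -> R) (x y l : R) :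
  derivable_pt_lim f y l ->
  differentiable_pt_lim (fun u v => exp u * f v) x y (exp x * f y) (exp x * l).
Proof.
intros Hf.
replace (exp x * f y) with (f y * exp x + exp x * 0) by ring.
replace (exp x * l) with (f y * 0 + exp x * l) by ring.
apply (differentiable_pt_lim_comp Rmult (fun u _ => exp u) (fun _ v => f v)).
- apply differentiable_pt_lim_mult.
- apply differentiable_pt_lim_proj1_0. apply derivable_pt_lim_exp.
- intros eps. destruct (Hf eps (cond_pos eps)) as [d Hd].
  exists d. intros u v _ Hv.
  destruct (Req_dec v y) as [-> | Hn].
  + replace (f y - f y - (0 * (u - x) + l * (y - y))) with 0 by ring. rewrite Rabs_R0.
    apply Rmult_le_pos; [left; apply cond_pos|].
    eapply Rle_trans; [apply Rabs_pos|apply Rmax_l].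
  + assert (Hvy : v - y <> 0) by lra.
    specialize (Hd (v - y) Hvy Hv). replace (y + (v - y)) with v in Hd by ring.
    replace (f v - f y - (0 * (u - x) + l * (v - y)))
      with (((f v - f y) / (v - y) - l) * (v - y)) by (field; exact Hvy).
    rewrite Rabs_mult. apply Rmult_le_compat; try apply Rabs_pos; [lra|apply Rmax_r].
Qed.

(** With w = x + i y, the form with these coefficients is the imaginary part of h(e^w) dw; the
    Cauchy-Riemann equations make the mixed partial derivatives agree. *)
Lemma cexp_closed_form (h : C -> C) (x y : R) (l : C) :
  cderiv h (cexp x y) l ->
  exists ax c b,
    differentiable_pt_lim (fun u v => Im (h (cexp u v))) x y ax c /\
    differentiable_pt_lim (fun u v => Re (h (cexp u v))) x y c b.
Proof.
intros Hl.
assert (Hc := differentiable_pt_lim_exp_mult cos x y _ (derivable_pt_lim_cos y)).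
assert (Hs := differentiable_pt_lim_exp_mult sin x y _ (derivable_pt_lim_sin y)).
assert (HA := differentiable_pt_lim_comp _ _ _ _ _ _ _ _ _ _ _ (cderiv_im _ _ _ _ Hl) Hc Hs).
assert (HB := differentiable_pt_lim_comp _ _ _ _ _ _ _ _ _ _ _ (cderiv_re _ _ _ _ Hl) Hc Hs).
eexists; eexists; eexists; split; [exact HA|].
match goal with |- differentiable_pt_lim _ _ _ ?c _ =>
  match type of HB with differentiable_pt_lim _ _ _ ?c' _ =>
    replace c with c' by ring end end.
exact HB.
Qed.

(** The circulation around [s, t] x [0, 2 PI] vanishes, and its horizontal edges cancel by
    periodicity. *)
Lemma circle_integral_eq (h : C -> C) (s t : R) :
  s < t < 0 ->
  (forall z : C, z <> 0%C -> in_disc z -> exists l, cderiv h z l) ->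
  RInt (fun y => Re (h (cexp s y))) 0 (0 + 2 * PI) =
  RInt (fun y => Re (h (cexp t y))) 0 (0 + 2 * PI).
Proof.
intros Hst Hh. assert (HPI := PI_RGT_0).
assert (HC := circulation_eq0 (fun u v => Im (h (cexp u v))) (fun u v => Re (h (cexp u v)))
  s 0 (t - s) (2 * PI)).
unfold circulation in HC. replace (s + (t - s)) with t in HC by ring.
rewrite (RInt_ext (fun u => Im (h (cexp u (0 + 2 * PI)))) (fun u => Im (h (cexp u 0)))) in HC.
- specialize (HC ltac:(lra) ltac:(lra)). cbv beta in HC.
  apply Rminus_diag_uniq_sym.
  refine (eq_trans _ (HC _)); [ring|].
  intros x y Hx _. destruct (Hh (cexp x y)) as [l Hl].
  + intros E. apply (f_equal Cmod) in E. rewrite Cmod_cexp, Cmod_0 in E.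
    generalize (exp_pos x); lra.
  + unfold in_disc. rewrite Cmod_cexp, <- exp_0. apply exp_increasing; lra.
  + exact (cexp_closed_form h x y l Hl).
- intros u _. unfold cexp. rewrite Rplus_0_l, cos_2PI, sin_2PI, cos_0, sin_0. reflexivity.
Qed.

(* Stated with a removable singularity at the origin, so that it also covers h(z) = (F(z) - F(0))/z. *)
Lemma circle_mean_positive (h : C -> C) (L r : R) :
  0 < r < 1 ->
  (forall z : C, z <> 0%C -> in_disc z -> exists l, cderiv h z l) ->
  (forall e, 0 < e -> exists d, 0 < d /\
     forall z : C, z <> 0%C -> Cmod z < d -> Re (h z) <= L + e) ->
  (forall z : C, Cmod z = r -> 0 <= Re (h z)) ->
  0 <= L.
Proof.
intros Hr Hh HL Hpos. assert (HPI := PI_RGT_0).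
apply Rnot_lt_le; intros HLneg.
destruct (HL (- L / 2) ltac:(lra)) as [d [Hd Hd']].
assert (Hln : ln r < 0) by (rewrite <- ln_1; apply ln_increasing; lra).
(* The radius exp s is below both r and d. If L < 0, then Re h <= L / 2 on that circle, so its mean
   is negative, while the mean at radius r is nonnegative. *)
set (s := Rmin (ln r - 1) (ln d - 1)).
assert (Hs1 : s <= ln r - 1) by apply Rmin_l.
assert (Hs2 : s <= ln d - 1) by apply Rmin_r.
assert (Hne : forall x y, cexp x y <> 0%C).
{ intros x y E. apply (f_equal Cmod) in E. rewrite Cmod_cexp, Cmod_0 in E.
  generalize (exp_pos x); lra. }
assert (Hint : forall x, x < 0 -> ex_RInt (fun y => Re (h (cexp x y))) 0 (0 + 2 * PI)).
{ intros x Hx. apply (ex_RInt_continuous (V := R_CompleteNormedModule)). intros y _.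
  destruct (Hh (cexp x y) (Hne x y)) as [l Hl].
  - unfold in_disc. rewrite Cmod_cexp, <- exp_0. now apply exp_increasing.
  - destruct (cexp_closed_form h x y l Hl) as [? [? [? [_ HB]]]].
    exact (differentiable_slice_y _ _ _ _ _ HB). }
assert (E := circle_integral_eq h s (ln r) ltac:(lra) Hh).
assert (H1 : 0 <= RInt (fun y => Re (h (cexp (ln r) y))) 0 (0 + 2 * PI)).
{ apply RInt_ge_0; [lra|apply Hint; lra|].
  intros y _. apply Hpos. rewrite Cmod_cexp. apply exp_ln; lra. }
assert (H2 : RInt (fun y => Re (h (cexp s y))) 0 (0 + 2 * PI)
  <= RInt (fun _ => L / 2) 0 (0 + 2 * PI)).
{ apply RInt_le; [lra|apply Hint; lra|apply ex_RInt_const|].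
  intros y _. replace (L / 2) with (L + - L / 2) by field.
  apply Hd'; [apply Hne|]. rewrite Cmod_cexp.
  rewrite <- (exp_ln d Hd). apply exp_increasing; lra. }
rewrite RInt_const in H2. unfold scal in H2; simpl in H2. unfold mult in H2; simpl in H2.
nra.
Qed.

(** * Schwarz-Pick *)

Lemma Cmod_sqr (z : C) : Cmod z ^ 2 = fst z ^ 2 + snd z ^ 2.
Proof. exact (Cmod2_alt z). Qed.

(** The right-hand side is the real part at the origin of an auxiliary function [h] whose real part
    on |z| = r is Re F times a weight, nonnegative since |c| <= 1 / 2. *)
Lemma caratheodory_weighted (F : C -> C) (l c : C) (r : R) :
  (forall z : C, in_disc z -> exists l, cderiv F z l) ->
  cderiv F 0%C l ->
  (forall z : C, in_disc z -> 0 <= Re (F z)) ->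
  0 < r < 1 -> Cmod c <= 1 / 2 ->
  0 <= Re (F 0%C + c * r * l)%C.
Proof.
intros HF Hl Hpos Hr Hc.
assert (Hr0 : RtoC r <> 0%C) by (intros E; injection E; lra).
set (F0 := F 0%C).
(* The natural term c F r / z has a pole at 0. Its singular part c F0 r / z is exchanged for conj(c
   F0) z / r, its conjugate on |z| = r, so the real part there is unchanged. *)
set (h := fun z : C => (F z + Cconj c * F z * (z / r) + c * r * ((F z - F0) / z)
  + Cconj (c * F0) * (z / r))%C).
apply (circle_mean_positive h (Re (F0 + c * r * l)%C) r Hr).
- intros z Hz Hzd. destruct (HF z Hzd) as [m Hm].
  assert (Hzr : cderiv (fun t => t / r)%C z (/ r)%C).
  { eapply cderiv_eq; [|exact (cderiv_div _ _ _ _ _ Hr0 (cderiv_id z) (cderiv_const r z))].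
    cbv beta. field. exact Hr0. }
  eexists. unfold h.
  apply cderiv_plus; [apply cderiv_plus; [apply cderiv_plus|]|].
  + exact Hm.
  + apply (cderiv_mult (fun t => Cconj c * F t)%C (fun t => t / r)%C); [|exact Hzr].
    apply (cderiv_mult (fun t => Cconj c) F); [apply cderiv_const|exact Hm].
  + apply (cderiv_mult (fun t => c * r)%C (fun t => (F t - F0) / t)%C); [apply cderiv_const|].
    apply (cderiv_div (fun t => F t - F0)%C (fun t => t)); [exact Hz| |apply cderiv_id].
    apply (cderiv_minus F (fun t => F0)); [exact Hm|apply cderiv_const].
  + apply (cderiv_mult (fun t => Cconj (c * F0)) (fun t => t / r)%C); [apply cderiv_const|exact Hzr].
- intros e He.
  (* [K] |z| bounds all of h - (F0 + c r l) except the first-order remainder of F divided by z,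
     which gets the other e / 2. Tolerance 1 in [H1] gives |F - F0| <= (|l| + 1) |z|. *)
  set (K := (Cmod l + 1) + 1 / 2 * ((Cmod F0 + (Cmod l + 1)) + Cmod F0) / r).
  assert (Kl := Cmod_ge_0 l). assert (KF := Cmod_ge_0 F0).
  assert (HK : 0 < K).
  { unfold K. apply Rplus_lt_le_0_compat; [lra|]. apply Rdiv_le_0_compat; lra. }
  destruct (proj1 (cderivP _ _ _) Hl 1 Rlt_0_1) as [d1 [Hd1 H1]].
  destruct (proj1 (cderivP _ _ _) Hl (e / 2) ltac:(lra)) as [d2 [Hd2 H2]].
  exists (Rmin (Rmin d1 d2) (Rmin 1 (e / 2 / K))).
  split; [repeat apply Rmin_glb_lt; try lra; apply Rdiv_lt_0_compat; lra|].
  intros z Hz Hzd.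
  assert (Hz1 := Rlt_le_trans _ _ _ Hzd (Rmin_l _ _)).
  assert (Hz2 := Rlt_le_trans _ _ _ Hzd (Rmin_r _ _)).
  assert (Hz11 := Rlt_le_trans _ _ _ Hz1 (Rmin_l _ _)).
  assert (Hz12 := Rlt_le_trans _ _ _ Hz1 (Rmin_r _ _)).
  assert (Hz21 := Rlt_le_trans _ _ _ Hz2 (Rmin_l _ _)).
  assert (Hz22 := Rlt_le_trans _ _ _ Hz2 (Rmin_r _ _)).
  replace (Cmod z) with (Cmod (z - 0)%C) in Hz11, Hz12 by (f_equal; ring).
  specialize (H1 z Hz11). specialize (H2 z Hz12). fold F0 in H1, H2.
  replace (z - 0)%C with z in H1, H2 by ring.
  assert (Hzp : 0 < Cmod z) by now apply Cmod_gt_0.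
  assert (HD : Cmod (F z - F0) <= (Cmod l + 1) * Cmod z).
  { replace (F z - F0)%C with ((F z - F0 - z * l) + z * l)%C by ring.
    eapply Rle_trans; [apply Cmod_triangle|]. rewrite Cmod_mult. lra. }
  assert (HFz : Cmod (F z) <= Cmod F0 + (Cmod l + 1)).
  { replace (F z) with (F0 + (F z - F0))%C by ring.
    eapply Rle_trans; [apply Cmod_triangle|]. nra. }
  assert (Hdec : (h z = (F0 + c * r * l) + ((F z - F0) +
    (z / r * (Cconj c * F z + Cconj c * Cconj F0) + c * r * ((F z - F0 - z * l) / z))))%C).
  { unfold h. rewrite Cmult_conj. field. split; assumption. }
  rewrite Hdec, re_plus. apply Rplus_le_compat_l.
  eapply Rle_trans; [apply Rle_abs|]. eapply Rle_trans; [apply re_le_Cmod|].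
  eapply Rle_trans; [apply Cmod_triangle|].
  eapply Rle_trans; [apply Rplus_le_compat_l; apply Cmod_triangle|].
  assert (Hcr : Cmod (c * r * ((F z - F0 - z * l) / z))%C <= e / 2).
  { rewrite !Cmod_mult, Cmod_div, Cmod_R, (Rabs_pos_eq r) by (auto; lra).
    assert (HQ : Cmod (F z - F0 - z * l) / Cmod z <= e / 2) by (apply Rle_div_l; lra).
    assert (Hcr1 : 0 <= Cmod c * r <= 1) by (generalize (Cmod_ge_0 c); nra).
    apply Rle_trans with (1 * (e / 2)); [|lra].
    apply Rmult_le_compat; try lra. apply Rdiv_le_0_compat; [apply Cmod_ge_0|exact Hzp]. }
  assert (Hmid : Cmod (z / r * (Cconj c * F z + Cconj c * Cconj F0))%C
    <= 1 / 2 * ((Cmod F0 + (Cmod l + 1)) + Cmod F0) / r * Cmod z).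
  { rewrite Cmod_mult, Cmod_div, Cmod_R, (Rabs_pos_eq r) by (auto; lra).
    replace (1 / 2 * ((Cmod F0 + (Cmod l + 1)) + Cmod F0) / r * Cmod z)
      with (Cmod z / r * (1 / 2 * ((Cmod F0 + (Cmod l + 1)) + Cmod F0))) by (field; lra).
    apply Rmult_le_compat_l; [apply Rdiv_le_0_compat; lra|].
    eapply Rle_trans; [apply Cmod_triangle|]. rewrite !Cmod_mult, !Cmod_conj.
    generalize (Cmod_ge_0 c) (Cmod_ge_0 (F z)). nra. }
  assert (HKz : K * Cmod z <= e / 2).
  { apply Rlt_le. rewrite Rmult_comm. apply Rlt_div_r; [exact HK|exact Hz22]. }
  unfold K in HKz. lra.
- intros z Hz.
  assert (Hzd : in_disc z) by (unfold in_disc; lra).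
  assert (Hz0 : z <> 0%C) by (intros ->; rewrite Cmod_0 in Hz; lra).
  (* On the circle, r / z is the conjugate of z / r, and h has real part
     Re F * (1 + 2 Re (conj c * z / r)). *)
  set (t := (z / r)%C).
  assert (Ht : Cmod t = 1).
  { unfold t. rewrite Cmod_div, Cmod_R, Hz, Rabs_pos_eq by (auto; lra). field; lra. }
  assert (Htt : (t * Cconj t = 1)%C).
  { rewrite <- Cmod2_conj, Ht. f_equal. ring. }
  assert (Hrz : (r / z = Cconj t)%C).
  { replace (r / z)%C with (/ t)%C by (unfold t; field; auto).
    assert (t <> 0%C) by (intros E; rewrite E, Cmod_0 in Ht; lra).
    replace (Cconj t) with (/ t * (t * Cconj t))%C by (field; auto). rewrite Htt. ring. }
  assert (Eh : h z = (F z + Cconj c * F z * t + c * (F z - F0) * Cconj t + Cconj (c * F0) * t)%C).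
  { rewrite <- Hrz. unfold h, t. field. auto. }
  assert (Er : Re (h z) = Re (F z) * (1 + 2 * Re (Cconj c * t)%C)).
  { rewrite Eh. destruct (F z), c, t, F0. unfold Re, Im; simpl. ring. }
  rewrite Er. apply Rmult_le_pos; [now apply Hpos|].
  assert (Hre := re_le_Cmod (Cconj c * t)%C).
  rewrite Cmod_mult, Cmod_conj, Ht in Hre. apply Rabs_le_between in Hre. lra.
Qed.

Lemma caratheodory (F : C -> C) (l : C) :
  (forall z : C, in_disc z -> exists l, cderiv F z l) ->
  cderiv F 0%C l ->
  (forall z : C, in_disc z -> 0 <= Re (F z)) ->
  Cmod l <= 2 * Re (F 0%C).
Proof.
intros HF Hl Hpos.
destruct (Req_dec (Cmod l) 0) as [E | Hne].
{ rewrite E. assert (0 <= Re (F 0%C)); [|lra].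
  apply Hpos. unfold in_disc. rewrite Cmod_0. lra. }
assert (Hlp : 0 < Cmod l) by (generalize (Cmod_ge_0 l); lra).
assert (Hm0 : RtoC (2 * Cmod l) <> 0%C) by (intros E; injection E; lra).
(* The extremal weight: it has modulus 1 / 2 and turns c l into -|l| / 2. *)
set (c := (- Cconj l / RtoC (2 * Cmod l))%C).
assert (Hc : Cmod c <= 1 / 2).
{ unfold c. rewrite Cmod_div, Cmod_opp, Cmod_conj, Cmod_R, Rabs_pos_eq by (auto; lra).
  right. field. lra. }
assert (Hcl : (c * l = RtoC (- (Cmod l / 2)))%C).
{ replace (c * l)%C with (- (l * Cconj l) / RtoC (2 * Cmod l))%C by (unfold c; field; auto).
  rewrite <- Cmod2_conj, <- RtoC_opp, <- RtoC_div by lra. f_equal. field. lra. }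
assert (H : forall r, 0 < r < 1 -> r * (Cmod l / 2) <= Re (F 0%C)).
{ intros r Hr. assert (HW := caratheodory_weighted F l c r HF Hl Hpos Hr Hc).
  replace (c * r * l)%C with (r * (c * l))%C in HW by ring.
  rewrite Hcl, re_plus, re_scal_l, re_RtoC in HW. lra. }
apply Rnot_lt_le; intros Hlt.
assert (H0 := H (1 / 2) ltac:(lra)).
(* This replaces the limit r -> 1: if q = 2 Re F(0) / |l| were below 1, the radius halfway between q
   and 1 would contradict [H]. The instance r = 1 / 2 provides q > 0. *)
assert (H1 := H ((1 + 2 * Re (F 0%C) / Cmod l) / 2)).
set (q := 2 * Re (F 0%C) / Cmod l) in *.
assert (Hq : q * Cmod l = 2 * Re (F 0%C)) by (unfold q; field; lra).
assert (Hq0 : 0 < q) by (unfold q; apply Rdiv_lt_0_compat; lra).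
assert (Hq1 : q < 1) by nra.
specialize (H1 ltac:(lra)). nra.
Qed.

(** * The Cayley transform and Schwarz-Pick on the half-plane *)

Definition cayley (z : C) : C := ((1 + z) / (1 - z))%C.

Lemma disc_neq1 (z : C) : in_disc z -> (1 - z)%C <> 0%C.
Proof.
unfold in_disc. intros Hz E. replace z with (1 - (1 - z))%C in Hz by ring.
rewrite E in Hz. replace (1 - 0)%C with (RtoC 1) in Hz by ring. rewrite Cmod_1 in Hz. lra.
Qed.

Lemma re_cayley (z : C) : (1 - z)%C <> 0%C ->
  Re (cayley z) = (1 - Cmod z ^ 2) / Cmod (1 - z) ^ 2.
Proof.
intros Hz.
assert (Hp : Cmod (1 - z) ^ 2 <> 0) by (apply pow_nonzero; intros E; now apply Cmod_eq_0 in E).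
revert Hp. rewrite !Cmod_sqr. destruct z as [x y].
unfold cayley, Re, Im; simpl. intros Hp. field.
intros E; apply Hp; refine (eq_trans _ E); ring.
Qed.

Lemma re_cayley_pos (z : C) : in_disc z -> 0 < Re (cayley z).
Proof.
intros Hz. rewrite re_cayley by now apply disc_neq1.
apply Rdiv_lt_0_compat.
- unfold in_disc in Hz. generalize (Cmod_ge_0 z); nra.
- apply pow_lt. apply Cmod_gt_0. now apply disc_neq1.
Qed.

Lemma cderiv_cayley (z : C) : (1 - z)%C <> 0%C ->
  cderiv cayley z (2 / ((1 - z) * (1 - z)))%C.
Proof.
intros Hz.
eapply cderiv_eq; [|apply (cderiv_div (fun t => 1 + t)%C (fun t => 1 - t)%C); [exact Hz| |]].
2: exact (cderiv_plus _ _ _ _ _ (cderiv_const 1%C z) (cderiv_id z)).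
2: exact (cderiv_minus _ _ _ _ _ (cderiv_const 1%C z) (cderiv_id z)).
cbv beta. field. exact Hz.
Qed.

(** [T] maps the disc into the right half-plane with T(0) = w and T'(0) = 2 Re w, so [caratheodory]
    for f after T gives 2 Re w |l| <= 2 Re f(w). *)
Lemma schwarz_pick (f : C -> C) (w l : C) :
  (forall w : C, 0 < Re w -> exists l, cderiv f w l) ->
  (forall w : C, 0 < Re w -> 0 <= Re (f w)) ->
  0 < Re w -> cderiv f w l ->
  Cmod l * Re w <= Re (f w).
Proof.
intros Hf Hpos Hw Hl.
set (T := fun z => (Re w * cayley z + (0, Im w))%C).
assert (HT0 : T 0%C = w).
{ unfold T, cayley. destruct w as [x y]. unfold Re, Im; simpl.
  apply injective_projections; simpl; field. }
assert (HTre : forall z : C, in_disc z -> 0 < Re (T z)).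
{ intros z Hz. unfold T. rewrite re_plus, re_scal_l.
  assert (H := re_cayley_pos z Hz).  change (Re (0, Im w)) with 0. nra. }
assert (HT' : forall z : C, in_disc z -> cderiv T z (Re w * (2 / ((1 - z) * (1 - z))))%C).
{ intros z Hz. unfold T.
  eapply cderiv_eq; [|apply (cderiv_plus (fun t => Re w * cayley t)%C (fun _ => (0, Im w)));
    [apply (cderiv_mult (fun _ => RtoC (Re w)) cayley)|];
    [apply cderiv_const|apply cderiv_cayley; now apply disc_neq1|apply cderiv_const]].
  cbv beta. field. now apply disc_neq1. }
assert (H0 : in_disc 0%C) by (unfold in_disc; rewrite Cmod_0; lra).
assert (HC := caratheodory (fun z => f (T z)) (Re w * (2 / ((1 - 0) * (1 - 0))) * l)%C).
cbv beta in HC. rewrite HT0 in HC.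
replace (Re w * (2 / ((1 - 0) * (1 - 0))) * l)%C with (RtoC (2 * Re w) * l)%C in HC
  by (rewrite RtoC_mult; field; replace (1 - 0)%C with (RtoC 1) by ring; intros E; injection E; lra).
rewrite Cmod_mult, Cmod_R, Rabs_pos_eq in HC by lra.
assert (2 * Re w * Cmod l <= 2 * Re (f w)); [|lra].
apply HC.
- intros z Hz. destruct (Hf (T z) (HTre z Hz)) as [m Hm].
  eexists. exact (cderiv_comp f T z _ _ Hm (HT' z Hz)).
- eapply cderiv_eq; [|apply (cderiv_comp f T); [rewrite HT0; exact Hl|exact (HT' _ H0)]].
  rewrite RtoC_mult. field.
- intros z Hz. apply Hpos. now apply HTre.
Qed.

(** * Sandwiched functions on the half-plane *)

Definition line (p d : C) (t : R) : C := (fst p + t * fst d, snd p + t * snd d).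

Lemma line0 (p d : C) : line p d 0 = p.
Proof. destruct p; unfold line; simpl; f_equal; ring. Qed.

Lemma line1 (p q : C) : line p (q - p) 1 = q.
Proof. destruct p, q; unfold line; simpl; f_equal; ring. Qed.

Lemma re_line_ge (p q : C) t : 0 <= t <= 1 ->
  Rmin (Re p) (Re q) <= Re (line p (q - p) t).
Proof.
intros Ht. assert (H1 := Rmin_l (Re p) (Re q)). assert (H2 := Rmin_r (Re p) (Re q)).
replace (Re (line p (q - p) t)) with ((1 - t) * Re p + t * Re q)
  by (unfold line, Re; simpl; ring).
nra.
Qed.

Lemma is_derive_affine (x v t : R) : is_derive (fun s => x + s * v) t v.
Proof. auto_derive; [exact I|ring]. Qed.

Lemma is_derive_re_line (f : C -> C) (p d l : C) (t : R) :
  cderiv f (line p d t) l ->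
  is_derive (fun s => Re (f (line p d s))) t (Re l * fst d - Im l * snd d).
Proof.
intros H. apply is_derive_Reals.
replace (Re l * fst d - Im l * snd d) with (Re l * fst d + - Im l * snd d) by ring.
apply (derivable_pt_lim_comp_2d (fun u v => Re (f (u, v)))
  (fun s => fst p + s * fst d) (fun s => snd p + s * snd d)).
- now apply cderiv_re.
- apply is_derive_Reals, is_derive_affine.
- apply is_derive_Reals, is_derive_affine.
Qed.

Lemma is_derive_im_line (f : C -> C) (p d l : C) (t : R) :
  cderiv f (line p d t) l ->
  is_derive (fun s => Im (f (line p d s))) t (Im l * fst d + Re l * snd d).
Proof.
intros H. apply is_derive_Reals.
apply (derivable_pt_lim_comp_2d (fun u v => Im (f (u, v)))
  (fun s => fst p + s * fst d) (fun s => snd p + s * snd d)).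
- now apply cderiv_im.
- apply is_derive_Reals, is_derive_affine.
- apply is_derive_Reals, is_derive_affine.
Qed.

Lemma decreasing_01 (g g' : R -> R) :
  (forall t, 0 <= t <= 1 -> is_derive g t (g' t) /\ g' t <= 0) -> g 1 <= g 0.
Proof.
intros H.
destruct (MVT_gen g 0 1 g') as [c [Hc E]].
- intros t Ht. rewrite Rmin_left, Rmax_right in Ht by lra. apply H; lra.
- intros t Ht. rewrite Rmin_left, Rmax_right in Ht by lra.
  apply continuity_pt_filterlim. apply (ex_derive_continuous (V := R_NormedModule)).
  exists (g' t). apply H; lra.
- rewrite Rmin_left, Rmax_right in Hc by lra.
  assert (g' c <= 0) by (apply H; lra). nra.
Qed.

(* Schwarz-Pick bounds the logarithmic derivative of [Re f] along the segment
   from [w] to [v], so a zero of [Re f] propagates. *)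
Lemma re_eq0_propagates (f : C -> C) (w v : C) :
  (forall w : C, 0 < Re w -> exists l, cderiv f w l) ->
  (forall w : C, 0 < Re w -> 0 <= Re (f w)) ->
  0 < Re w -> 0 < Re v -> Re (f w) = 0 -> Re (f v) = 0.
Proof.
intros Hf Hpos Hw Hv E.
set (m := Rmin (Re w) (Re v)).
assert (Hm : 0 < m) by now apply Rmin_glb_lt.
set (d := (v - w)%C).
set (K := Cmod d / m).
set (g := fun t => Re (f (line w d t))).
assert (Hg : forall t, 0 <= t <= 1 -> exists g', is_derive g t g' /\ g' <= K * g t).
{ intros t Ht. assert (Hl := re_line_ge w v t Ht). fold m d in Hl.
  destruct (Hf (line w d t) ltac:(lra)) as [l Hl'].
  exists (Re l * fst d - Im l * snd d). split; [now apply is_derive_re_line|].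
  assert (HS := schwarz_pick f (line w d t) l Hf Hpos ltac:(lra) Hl'). fold (g t) in HS.
  apply Rle_trans with (Cmod l * Cmod d).
  - rewrite <- Cmod_mult. eapply Rle_trans; [apply Rle_abs|].
    replace (Re l * fst d - Im l * snd d) with (Re (l * d)%C) by (unfold Re, Im; simpl; ring).
    apply re_le_Cmod.
  - unfold K. replace (Cmod d / m * g t) with (g t / m * Cmod d) by (field; lra).
    apply Rmult_le_compat_r; [apply Cmod_ge_0|]. apply Rle_div_r; [exact Hm|].
    apply Rle_trans with (2 := HS). apply Rmult_le_compat_l; [apply Cmod_ge_0|exact Hl]. }
(* Gronwall: g' <= K g makes g(t) exp(-K t) nonincreasing, so g(0) = 0 and g >= 0 force g(1) = 0. *)
assert (H : g 1 * exp (- K * 1) <= g 0 * exp (- K * 0)).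
{ apply (decreasing_01 (fun t => g t * exp (- K * t))
    (fun t => (Derive g t - K * g t) * exp (- K * t))).
  intros t Ht. destruct (Hg t Ht) as [g' [Hg' Hle]].
  rewrite (is_derive_unique g t g' Hg'). split.
  - auto_derive; [now exists g'|].  replace (Derive (fun x => g x) t) with g' by (symmetry; exact (is_derive_unique g t g' Hg')); ring.
  - generalize (exp_pos (- K * t)). nra. }
unfold g in H. rewrite line0, E in H. unfold d in H. rewrite line1 in H.
specialize (Hpos v Hv). generalize (exp_pos (- K * 1)). nra.
Qed.

Lemma derivative_of_sandwiched (f : C -> C) (w l : C) :
  (forall w : C, 0 < Re w -> exists l, cderiv f w l) ->
  (forall w : C, 0 < Re w -> 0 <= Re (f w) <= Re w) ->
  0 < Re w -> cderiv f w l ->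
  Re l * Re w = Re (f w) /\ Im l = 0.
Proof.
intros Hf Hb Hw Hl.
assert (H1 := schwarz_pick f w l Hf (fun w Hw => proj1 (Hb w Hw)) Hw Hl).
assert (H2 : Cmod (1 - l) * Re w <= Re w - Re (f w)).
{ replace (Re w - Re (f w)) with (Re (w - f w)%C) by (unfold Re; simpl; ring).
  apply (schwarz_pick (fun w => w - f w)%C w (1 - l)%C).
  - intros v Hv. destruct (Hf v Hv) as [m Hm]. exists (1 - m)%C.
    exact (cderiv_minus _ _ _ _ _ (cderiv_id v) Hm).
  - intros v Hv. specialize (Hb v Hv). unfold Re in *; simpl. lra.
  - exact Hw.
  - exact (cderiv_minus _ _ _ _ _ (cderiv_id w) Hl). }
assert (H3 := re_le_Cmod l). assert (H4 := re_le_Cmod (1 - l)%C).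
apply Rabs_le_between in H3. apply Rabs_le_between in H4.
replace (Re (1 - l)%C) with (1 - Re l) in H4 by (unfold Re; simpl; ring).
(* With q = Re f(w) / Re w, the chains Re l <= |l| <= q and 1 - Re l <= |1 - l| <= 1 - q must be
   equalities; |l| = Re l then kills the imaginary part. *)
assert (E : Re l * Re w = Re (f w)) by nra.
split; [exact E|].
assert (E2 : Cmod l = Re l) by nra.
assert (E3 := Cmod2_alt l). rewrite E2 in E3. nra.
Qed.

(* Re w is a minimal positive harmonic function on the right half-plane. *)
Lemma sandwiched_affine (f : C -> C) :
  (forall w : C, 0 < Re w -> exists l, cderiv f w l) ->
  (forall w : C, 0 < Re w -> 0 <= Re (f w) <= Re w) ->
  exists a b, 0 <= b <= 1 /\
    forall w : C, 0 < Re w -> f w = (b * w - (0, a))%C.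
Proof.
intros Hf Hb.
assert (H1 : 0 < Re 1) by (simpl; lra).
set (b := Re (f 1%C)).
exists (- Im (f 1%C)), b.
split; [exact (Hb 1%C H1)|].
assert (Hpos : forall w t, 0 < Re w -> 0 <= t <= 1 -> 0 < Re (line 1 (w - 1) t)).
{ intros w t Hw Ht. assert (Hl := re_line_ge 1%C w t Ht).
  assert (0 < Rmin (Re 1) (Re w)) by now apply Rmin_glb_lt. lra. }
assert (Hre : forall w : C, 0 < Re w -> Re (f w) = b * Re w).
{ intros w Hw.
  (* Along the segment from 1 to w this ratio has derivative zero, because f' is real and equal to
     the ratio itself. *)
  set (k := fun t => Re (f (line 1 (w - 1) t)) / Re (line 1 (w - 1) t)).
  assert (E : k 0 = k 1).
  { apply (eq_is_derive k 0 1); [|lra]. intros t Ht.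
    assert (Hp := Hpos w t Hw Ht).
    destruct (Hf _ Hp) as [l Hl].
    destruct (derivative_of_sandwiched f _ l Hf Hb Hp Hl) as [E1 E2].
    assert (Hd := is_derive_re_line f 1%C (w - 1)%C l t Hl).
    assert (Hx := is_derive_affine (fst (RtoC 1)) (fst (w - 1)%C) t).
    assert (HQ := is_derive_div _ _ t _ _ Hd Hx (Rgt_not_eq _ _ Hp)).
    cbv beta in HQ.
    change (fst (RtoC 1) + t * fst (w - 1)%C) with (Re (line 1 (w - 1) t)) in HQ.
    rewrite <- E1, E2 in HQ.
    match type of HQ with is_derive _ _ ?v =>
      match goal with |- is_derive _ _ ?u => replace u with v; [exact HQ|] end end.
    match goal with |- ?a = _ => change (a = 0) end. field. lra. }
  unfold k in E. rewrite line0, line1 in E. fold b in E.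
  simpl Re in E. rewrite Rdiv_1_r in E. rewrite E. field. lra. }
intros w Hw.
assert (Him : Im (f w) = Im (f 1%C) + b * Im w).
{ set (k := fun t => Im (f (line 1 (w - 1) t)) - b * t * Im w).
  assert (E : k 0 = k 1).
  { apply (eq_is_derive k 0 1); [|lra]. intros t Ht.
    assert (Hp := Hpos w t Hw Ht).
    destruct (Hf _ Hp) as [l Hl].
    destruct (derivative_of_sandwiched f _ l Hf Hb Hp Hl) as [E1 E2].
    (* Now f' = b at every point of the segment, so Im f grows exactly like b times the imaginary
       part of the argument. *)
    rewrite (Hre _ Hp) in E1. apply Rmult_eq_reg_r in E1; [|lra].
    assert (Hd := is_derive_im_line f 1%C (w - 1)%C l t Hl).
    assert (Hx : is_derive (fun t => b * t * Im w) t (b * Im w)).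
    { auto_derive; [exact I|ring]. }
    assert (HQ := is_derive_minus _ _ t _ _ Hd Hx).
    rewrite E1, E2 in HQ.
    match type of HQ with is_derive _ _ ?v =>
      match goal with |- is_derive _ _ ?u => replace u with v; [exact HQ|] end end.
    match goal with |- ?a = _ => change (a = 0) end.
    unfold minus, plus, opp; simpl. unfold Im. ring. }
  unfold k in E. rewrite line0, line1 in E. lra. }
apply injective_projections.
- change (Re (f w) = Re (b * w - (0, (- Im (f 1%C))%R))%C). rewrite Hre by exact Hw.
  unfold Re; simpl. ring.
- change (Im (f w) = Im (b * w - (0, (- Im (f 1%C))%R))%C). rewrite Him.
  unfold Im; simpl. ring.
Qed.

(** * Self-maps of the disc *)

Definition cayley_inv (w : C) : C := ((w - 1) / (w + 1))%C.

Lemma re_pos_neq0 (w : C) : 0 < Re w -> w <> 0%C.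
Proof. intros H ->. simpl in H. lra. Qed.

Lemma one_sub_cayley_inv (w : C) : (w + 1)%C <> 0%C ->
  (1 - cayley_inv w = 2 / (w + 1))%C.
Proof. intros H. unfold cayley_inv. field. exact H. Qed.

Lemma C2_neq0 : RtoC 2 <> 0%C.
Proof. intros E; injection E; lra. Qed.

Lemma cayley_inv_neq1 (w : C) : (w + 1)%C <> 0%C -> (1 - cayley_inv w)%C <> 0%C.
Proof.
intros H. rewrite one_sub_cayley_inv by exact H.
apply Cmult_neq_0; [exact C2_neq0|]. intros E.
apply C2_neq0. replace (RtoC 2) with (2 * (w + 1) * / (w + 1))%C by (field; exact H).
rewrite <- Cmult_assoc, (Cmult_comm _ (/ _)), E. ring.
Qed.

Lemma cayleyK (w : C) : (w + 1)%C <> 0%C -> cayley (cayley_inv w) = w.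
Proof.
intros H. unfold cayley. rewrite one_sub_cayley_inv by exact H.
unfold cayley_inv. field. exact H.
Qed.

Lemma cayley_inj (z z' : C) : (1 - z)%C <> 0%C -> (1 - z')%C <> 0%C ->
  cayley z = cayley z' -> z = z'.
Proof.
intros H H' E.
assert (K : forall u : C, (1 - u)%C <> 0%C -> u = cayley_inv (cayley u)).
{ intros u Hu. unfold cayley_inv, cayley. field. split; [exact Hu|].
  replace (1 + u + (1 - u))%C with (RtoC 2) by ring. exact C2_neq0. }
rewrite (K z H), (K z' H'). now rewrite E.
Qed.

Lemma re_plus1_neq0 (w : C) : 0 <= Re w -> (w + 1)%C <> 0%C.
Proof. intros H. apply re_pos_neq0. rewrite re_plus. simpl (Re 1). lra. Qed.

Lemma in_disc_re_cayley (z : C) : (1 - z)%C <> 0%C -> 0 < Re (cayley z) -> in_disc z.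
Proof.
intros Hz. rewrite re_cayley by exact Hz. intros H.
assert (Hp : 0 < Cmod (1 - z) ^ 2) by (apply pow_lt; now apply Cmod_gt_0).
unfold in_disc. apply Rnot_le_lt. intros Hge.
assert (Hn : (1 - Cmod z ^ 2) <= 0) by nra.
apply Rinv_0_lt_compat in Hp. unfold Rdiv in H. nra.
Qed.

Lemma re_cayley_ge0 (z : C) : (1 - z)%C <> 0%C -> Cmod z <= 1 -> 0 <= Re (cayley z).
Proof.
intros Hz H. rewrite re_cayley by exact Hz. apply Rdiv_le_0_compat.
- generalize (Cmod_ge_0 z); nra.
- apply pow_lt; now apply Cmod_gt_0.
Qed.

Lemma cayley_inv_disc (w : C) : 0 < Re w -> in_disc (cayley_inv w).
Proof.
intros Hw. assert (H : (w + 1)%C <> 0%C) by (apply re_plus1_neq0; lra).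
apply in_disc_re_cayley; [now apply cayley_inv_neq1|now rewrite cayleyK].
Qed.

Lemma cderiv_cayley_inv (w : C) : (w + 1)%C <> 0%C ->
  exists l, cderiv cayley_inv w l.
Proof.
intros H. eexists.
apply (cderiv_div (fun t => t - 1)%C (fun t => t + 1)%C); [exact H| |].
- exact (cderiv_minus _ _ _ _ _ (cderiv_id w) (cderiv_const 1%C w)).
- exact (cderiv_plus _ _ _ _ _ (cderiv_id w) (cderiv_const 1%C w)).
Qed.

(* The map of condition (3) is the affine map w |-> b w - i a, read in the half-plane. *)
Lemma mobius_cayley (a b : R) (z u : C) :
  0 <= b -> in_disc z ->
  let alpha := Cdiv (1 + b, a) (1 + b, - a) in
  let beta := Cdiv (1 - b, a) (1 + b, a) in
  u = (alpha * ((z - beta) / (1 - Cconj beta * z)))%C <->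
  (1 - u)%C <> 0%C /\ cayley u = (b * cayley z - (0, a))%C.
Proof.
intros Hb Hz alpha beta.
assert (H1z := disc_neq1 z Hz).
set (N := (0, a) : C).
set (v := (b * cayley z - N)%C).
assert (Hv : 0 <= Re v).
{ unfold v, Cminus. rewrite re_plus, re_scal_l. assert (H := re_cayley_pos z Hz).
  replace (Re (- N)) with 0 by (unfold N, Re; simpl; ring). nra. }
assert (Hv1 := re_plus1_neq0 v Hv).
assert (Hp : (1 + b + N)%C <> 0%C).
{ apply re_pos_neq0. unfold N, Re; simpl. lra. }
assert (Hp' : (1 + b - N)%C <> 0%C).
{ apply re_pos_neq0. unfold N, Re; simpl. lra. }
assert (HN : forall c : R, ((c, a) : C) = (c + N)%C).
{ intros c. unfold N. apply injective_projections; simpl; ring. }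
assert (HN' : forall c : R, ((c, - a) : C) = (c - N)%C).
{ intros c. unfold N. apply injective_projections; simpl; ring. }
assert (Ea : alpha = ((1 + b + N) / (1 + b - N))%C).
{ unfold alpha. rewrite HN, HN', RtoC_plus. reflexivity. }
assert (Eb : beta = ((1 - b + N) / (1 + b + N))%C).
{ unfold beta. rewrite !HN, RtoC_plus, RtoC_minus. reflexivity. }
assert (Ec : Cconj beta = ((1 - b - N) / (1 + b - N))%C).
{ rewrite Eb. unfold Cdiv. rewrite Cmult_conj, Cinv_conj by exact Hp.
  f_equal; [|f_equal]; unfold N; apply injective_projections; simpl; ring. }
(* Cleared of fractions, the denominator and numerator of the Moebius map are (1 - z)(v + 1) and (1
   - z)(v - 1), so the quotient is [cayley_inv v]; Re v >= 0 keeps v + 1 off 0. *)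
assert (ED : ((1 + b - N) - (1 - b - N) * z = (1 - z) * (v + 1))%C).
{ unfold v, cayley. field. exact H1z. }
assert (HD : ((1 + b - N) - (1 - b - N) * z)%C <> 0%C).
{ rewrite ED. now apply Cmult_neq_0. }
assert (E : (alpha * ((z - beta) / (1 - Cconj beta * z)) = cayley_inv v)%C).
{ rewrite Ec, Ea, Eb. unfold cayley_inv.
  transitivity (((1 + b + N) * z - (1 - b + N)) / ((1 + b - N) - (1 - b - N) * z))%C.
  - field. auto.
  - rewrite ED.
    replace ((1 + b + N) * z - (1 - b + N))%C with ((1 - z) * (v - 1))%C
      by (unfold v, cayley; field; exact H1z).
    field. auto. }
rewrite E. split.
- intros ->. split; [now apply cayley_inv_neq1|now apply cayleyK].
- intros [Hu Hc]. apply cayley_inj; [exact Hu|now apply cayley_inv_neq1|].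
  rewrite cayleyK by exact Hv1. exact Hc.
Qed.

Lemma unit_circle_angle (u : C) : Cmod u = 1 -> u <> 1%C ->
  exists theta, 0 < theta < 2 * PI /\ u = (cos theta, sin theta).
Proof.
intros Hu Hn. assert (HPI := PI_RGT_0).
destruct u as [p q]. assert (E := Cmod_sqr (p, q)). rewrite Hu in E. simpl fst in E; simpl snd in E.
assert (Hp : -1 <= p <= 1) by nra.
assert (Hsq : sqrt (1 - p²) = Rabs q).
{ rewrite <- sqrt_Rsqr_abs. f_equal. unfold Rsqr. lra. }
assert (Hlt : p < 1).
{ destruct (Req_dec p 1) as [-> | ]; [|lra]. exfalso. apply Hn.
  apply injective_projections; simpl; [reflexivity|nra]. }
assert (Hac : 0 < acos p).
{ destruct (acos_bound p) as [H _]. destruct (Req_dec (acos p) 0) as [E0 | ]; [|lra].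
  assert (cos (acos p) = p) by (now apply cos_acos). rewrite E0, cos_0 in H0. lra. }
assert (Hab := acos_bound p).
(* [acos p] is the angle on the closed upper half circle, and the lower half is its reflection.
   Since p < 1, neither choice reaches 0 or 2 PI. *)
destruct (Rle_lt_dec 0 q) as [Hq | Hq].
- exists (acos p). split; [lra|].
  rewrite cos_acos, sin_acos, Hsq, Rabs_pos_eq by lra. reflexivity.
- exists (2 * PI - acos p). split; [lra|].
  rewrite cos_minus, sin_minus, cos_2PI, sin_2PI, cos_acos, sin_acos, Hsq, Rabs_left by lra.
  f_equal; ring.
Qed.

(** * The four conditions read in the half-plane *)

(** For M > 0 the region is a horodisc at 1, which the Cayley transform sends to the half-plane Re >
    1 / M. The product form avoids dividing by M. *)
Lemma stolz_cayley (M : R) (z : C) : in_disc z ->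
  (stolz M z <-> 1 < M * Re (cayley z)).
Proof.
intros Hz. assert (H1 := disc_neq1 z Hz). unfold stolz. rewrite re_cayley by exact H1.
assert (Hp : 0 < Cmod (1 - z) ^ 2) by (apply pow_lt; now apply Cmod_gt_0).
replace (M * ((1 - Cmod z ^ 2) / Cmod (1 - z) ^ 2)) with (M * (1 - Cmod z ^ 2) / Cmod (1 - z) ^ 2)
  by (unfold Rdiv; ring).
rewrite <- Rlt_div_r by exact Hp. rewrite Rmult_1_l. tauto.
Qed.

Lemma julia_quotient (z : C) : in_disc z ->
  Cmod (1 - z) ^ 2 / (1 - Cmod z ^ 2) = / Re (cayley z).
Proof.
intros Hz. assert (H1 := disc_neq1 z Hz).
assert (HR := re_cayley_pos z Hz). rewrite re_cayley in * by exact H1.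
assert (Hp := proj1 (Cmod_gt_0 _) H1).
assert (1 - Cmod z ^ 2 <> 0) by (intros E; rewrite E in HR; unfold Rdiv in HR; lra).
field. split; lra.
Qed.

(** Both quotients are reciprocals of positive Poisson kernels, so the order reverses. *)
Lemma julia_quotient_le (z u : C) : in_disc z -> in_disc u ->
  (Cmod (1 - u) ^ 2 / (1 - Cmod u ^ 2) >= Cmod (1 - z) ^ 2 / (1 - Cmod z ^ 2)
   <-> Re (cayley u) <= Re (cayley z)).
Proof.
intros Hz Hu. rewrite !julia_quotient by assumption.
assert (Pz := re_cayley_pos z Hz). assert (Pu := re_cayley_pos u Hu).
split; intros H.
- apply Rnot_lt_le. intros Hlt.
  assert (/ Re (cayley u) < / Re (cayley z)); [|lra].
  apply Rinv_lt_contravar; [now apply Rmult_lt_0_compat|exact Hlt].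
- apply Rle_ge. now apply Rinv_le_contravar.
Qed.

Lemma re_neg_cayley (z : C) : (1 - z)%C <> 0%C ->
  Re ((z + 1) / (z - 1))%C = - Re (cayley z).
Proof.
intros H. rewrite <- re_opp. f_equal. unfold cayley. field. split; [exact H|].
intros E. apply H. replace (1 - z)%C with (- (z - 1))%C by ring. rewrite E. ring.
Qed.

(** A maximum principle that makes all denominators 1 - psi nonzero. If psi(z) = 1, the zero of the
    nonnegative Re (1 - psi) propagates to z0, and a value of modulus at most 1 with real part 1 is
    1. *)
Lemma value_neq1_of_neq1 (psi : C -> C) (z : C) :
  holomorphic_on_disc psi -> sup_norm_le1 psi ->
  (exists z0 : C, in_disc z0 /\ psi z0 <> RtoC 1) ->
  in_disc z -> (1 - psi z)%C <> 0%C.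
Proof.
intros Hhol Hbd [z0 [Hz0 Hn]] Hz E.
assert (Hc : forall z : C, in_disc z -> (cayley z + 1)%C <> 0%C).
{ intros y Hy. apply re_plus1_neq0. left. now apply re_cayley_pos. }
assert (Hinv : forall z : C, in_disc z -> cayley_inv (cayley z) = z).
{ intros y Hy. apply cayley_inj; [apply cayley_inv_neq1; auto|now apply disc_neq1|].
  apply cayleyK; auto. }
assert (H : Re (1 - psi (cayley_inv (cayley z0)))%C = 0).
{ apply (re_eq0_propagates (fun w => 1 - psi (cayley_inv w))%C (cayley z) (cayley z0)).
  - intros w Hw.
    destruct (ex_derive_cderiv psi _ (Hhol _ (cayley_inv_disc w Hw))) as [l Hl].
    destruct (cderiv_cayley_inv w) as [m Hm]; [apply re_plus1_neq0; lra|].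
    exists (0 - m * l)%C.
    exact (cderiv_minus _ _ _ _ _ (cderiv_const 1%C w) (cderiv_comp psi cayley_inv w _ _ Hl Hm)).
  - intros w Hw. assert (HB := Hbd _ (cayley_inv_disc w Hw)).
    assert (HR := re_le_Cmod (psi (cayley_inv w))). apply Rabs_le_between in HR.
    replace (Re (1 - psi (cayley_inv w))%C) with (1 - Re (psi (cayley_inv w)))
      by (unfold Re; simpl; ring). lra.
  - now apply re_cayley_pos.
  - now apply re_cayley_pos.
  - rewrite Hinv by exact Hz. rewrite E. reflexivity. }
rewrite Hinv in H by exact Hz0.
assert (HB := Cmod_sqr (psi z0)). assert (HM := Hbd z0 Hz0). assert (HM0 := Cmod_ge_0 (psi z0)).
apply Hn. unfold Re in H; simpl in H.
apply injective_projections; simpl; [lra|].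
replace (fst (psi z0)) with 1 in HB by lra. nra.
Qed.

(** Transported to the half-plane, |psi| <= 1 is the lower half of the sandwich and the last
    hypothesis is the upper half. *)
Lemma cayley_comp_affine (psi : C -> C) :
  holomorphic_on_disc psi -> sup_norm_le1 psi ->
  (forall z : C, in_disc z -> (1 - psi z)%C <> 0%C) ->
  (forall z : C, in_disc z -> Re (cayley (psi z)) <= Re (cayley z)) ->
  exists a b, 0 <= b <= 1 /\
    forall z : C, in_disc z -> cayley (psi z) = (b * cayley z - (0, a))%C.
Proof.
intros Hhol Hbd Hn H.
destruct (sandwiched_affine (fun w => cayley (psi (cayley_inv w)))) as [a [b [Hb E]]].
- intros w Hw. assert (Hd := cayley_inv_disc w Hw).
  destruct (ex_derive_cderiv psi _ (Hhol _ Hd)) as [l Hl].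
  destruct (cderiv_cayley_inv w) as [m Hm]; [apply re_plus1_neq0; lra|].
  eexists. eapply (cderiv_comp cayley (fun w => psi (cayley_inv w))).
  + apply cderiv_cayley. now apply Hn.
  + exact (cderiv_comp psi cayley_inv w _ _ Hl Hm).
- intros w Hw. assert (Hd := cayley_inv_disc w Hw). split.
  + apply re_cayley_ge0; [now apply Hn|now apply Hbd].
  + specialize (H _ Hd). rewrite (cayleyK w) in H by (apply re_plus1_neq0; lra). exact H.
- exists a, b. split; [exact Hb|]. intros z Hz.
  assert (Hc : (cayley z + 1)%C <> 0%C).
  { apply re_plus1_neq0. left. now apply re_cayley_pos. }
  rewrite <- (E (cayley z)) by now apply re_cayley_pos. do 2 f_equal.
  apply cayley_inj; [now apply disc_neq1|now apply cayley_inv_neq1|].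
  now rewrite cayleyK.
Qed.

(** If b = 0, the transported map is the constant -i a, a boundary point. If b > 0, it is invertible
    on the half-plane, and b <= 1 means that it does not increase real parts, which is the Stolz
    condition. *)
Lemma affine_const_or_automorphism (psi : C -> C) (a b : R) :
  holomorphic_on_disc psi -> sup_norm_le1 psi -> 0 <= b <= 1 ->
  (forall z : C, in_disc z ->
     (1 - psi z)%C <> 0%C /\ cayley (psi z) = (b * cayley z - (0, a))%C) ->
  (exists theta : R, 0 < theta < 2 * PI /\
     forall z : C, in_disc z -> psi z = (cos theta, sin theta))
  \/
  (disc_automorphism psi /\
   forall M : R, 0 < M ->
     forall z : C, in_disc z -> stolz M (psi z) -> stolz M z).
Proof.
intros Hhol Hbd Hb H.
assert (Hre : forall z : C, in_disc z -> Re (cayley (psi z)) = b * Re (cayley z)).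
{ intros z Hz. rewrite (proj2 (H z Hz)). unfold Re; simpl. ring. }
destruct (Req_dec b 0) as [Eb | Hb0].
- left.
  assert (H0 : in_disc 0%C) by (unfold in_disc; rewrite Cmod_0; lra).
  destruct (unit_circle_angle (psi 0%C)) as [theta [Ht E]].
  + assert (HR := Hre _ H0). rewrite Eb, Rmult_0_l in HR.
    assert (Hn := proj1 (H _ H0)). rewrite re_cayley in HR by exact Hn.
    assert (Hp : 0 < Cmod (1 - psi 0%C) ^ 2) by (apply pow_lt; now apply Cmod_gt_0).
    apply Rinv_0_lt_compat in Hp. unfold Rdiv in HR.
    assert (Hm := Cmod_ge_0 (psi 0%C)).
    apply Rmult_integral in HR. destruct HR; [nra|lra].
  + intros E. apply (proj1 (H _ H0)). rewrite E. ring.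
  + exists theta. split; [exact Ht|]. intros z Hz. rewrite <- E.
    apply cayley_inj; [apply H; exact Hz|apply H; exact H0|].
    rewrite (proj2 (H z Hz)), (proj2 (H _ H0)), Eb. ring.
- right.
  assert (Hbp : 0 < b) by lra.
  assert (HbC : RtoC b <> 0%C) by (intros E; injection E; lra).
  assert (Hdisc : forall z : C, in_disc z -> in_disc (psi z)).
  { intros z Hz. apply in_disc_re_cayley; [now apply H|]. rewrite Hre by exact Hz.
    apply Rmult_lt_0_compat; [exact Hbp|now apply re_cayley_pos]. }
  split; [split; [exact Hhol|split; [exact Hdisc|]]|].
  + intros w Hw.
    (* The preimage of [cayley w] under the affine map v |-> b v - i a. *)
    set (v := (/ b * (cayley w + (0, a)))%C).
    assert (Hv : 0 < Re v).
    { unfold v. rewrite <- RtoC_inv by exact Hb0. rewrite re_scal_l, re_plus.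
      change (Re (0, a)) with 0. rewrite Rplus_0_r.
      apply Rmult_lt_0_compat; [now apply Rinv_0_lt_compat|now apply re_cayley_pos]. }
    assert (Hv1 : (v + 1)%C <> 0%C) by (apply re_plus1_neq0; lra).
    assert (Hd := cayley_inv_disc v Hv).
    exists (cayley_inv v). split; [exact Hd|].
    assert (Ew : psi (cayley_inv v) = w).
    { apply cayley_inj; [now apply H|now apply disc_neq1|].
      rewrite (proj2 (H _ Hd)), cayleyK by exact Hv1. unfold v. field. exact HbC. }
    split; [exact Ew|]. intros z' Hz' Ez'.
    apply cayley_inj; [now apply disc_neq1|now apply disc_neq1|].
    assert (E : (b * cayley z' - (0, a) = b * cayley (cayley_inv v) - (0, a))%C).
    { rewrite <- (proj2 (H _ Hz')), <- (proj2 (H _ Hd)). now rewrite Ez', Ew. }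
    replace (cayley z') with (/ b * ((b * cayley z' - (0, a)) + (0, a)))%C by (field; exact HbC).
    rewrite E. field. exact HbC.
  + intros M HM z Hz. rewrite !stolz_cayley by auto. rewrite Hre by exact Hz.
    assert (HP := re_cayley_pos z Hz). intros HS.
    assert (b * Re (cayley z) <= Re (cayley z)) by nra. nra.
Qed.

(** Taking M = 1 / Re (cayley z) puts z on the boundary of its region, hence outside it. If psi(z)
    had a larger real part in the half-plane, it would lie inside and force z inside too. *)
Lemma stolz_stable_le (psi : C -> C) (z : C) :
  (forall M : R, 0 < M -> forall z : C, in_disc z -> stolz M (psi z) -> stolz M z) ->
  in_disc z -> in_disc (psi z) -> Re (cayley (psi z)) <= Re (cayley z).
Proof.
intros H Hz Hp. assert (Pz := re_cayley_pos z Hz). assert (Pp := re_cayley_pos _ Hp).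
apply Rnot_lt_le. intros Hlt.
assert (HM := H (/ Re (cayley z)) (Rinv_0_lt_compat _ Pz) z Hz).
rewrite !stolz_cayley, Rinv_l in HM by (auto; lra).
apply (Rlt_irrefl 1), HM.
rewrite Rmult_comm. apply Rlt_div_r; lra.
Qed.

Theorem theorem5p2 (psi : C -> C)
  (Hhol : holomorphic_on_disc psi)
  (Hbd : sup_norm_le1 psi)
  (Hn1 : exists z0 : C, in_disc z0 /\ psi z0 <> RtoC 1) :
  let c1 := RtoC 1 in
  let P1 := forall z : C, in_disc z ->
      Re (Cdiv (Cplus (psi z) c1) (Cminus (psi z) c1))
        >= Re (Cdiv (Cplus z c1) (Cminus z c1)) in
  let P2 := forall z : C, in_disc z -> Cmod (psi z) < 1 ->
      (Cmod (Cminus c1 (psi z))) ^ 2 / (1 - (Cmod (psi z)) ^ 2)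
        >= (Cmod (Cminus c1 z)) ^ 2 / (1 - (Cmod z) ^ 2) in
  let P3 := exists a b : R, 0 <= b <= 1 /\
      let alpha := Cdiv (1 + b, a) (1 + b, - a) in
      let beta := Cdiv (1 - b, a) (1 + b, a) in
      forall z : C, in_disc z ->
        psi z = Cmult alpha
                  (Cdiv (Cminus z beta) (Cminus c1 (Cmult (Cconj beta) z))) in
  let P4 :=
      (exists theta : R, 0 < theta < 2 * PI /\
         forall z : C, in_disc z -> psi z = (cos theta, sin theta))
      \/
      (disc_automorphism psi /\
       forall M : R, 0 < M ->
         forall z : C, in_disc z -> stolz M (psi z) -> stolz M z) in
  (P1 <-> P2) /\ (P2 <-> P3) /\ (P3 <-> P4).
Proof.
intros c1 P1 P2 P3 P4.
assert (Hn : forall z : C, in_disc z -> (1 - psi z)%C <> 0%C)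
  by (intros z; now apply value_neq1_of_neq1).
(* [Q] is the half-plane form of both (1) and (2); the rest is the cycle (2) -> (3) -> (4) ->
   (2). *)
set (Q := forall z : C, in_disc z -> Re (cayley (psi z)) <= Re (cayley z)).
assert (H1 : P1 <-> Q).
{ unfold P1, Q, c1. split; intros H z Hz; specialize (H z Hz);
  rewrite !re_neg_cayley in * by (auto using disc_neq1); lra. }
assert (H2 : P2 <-> Q).
{ unfold P2, Q, c1. split; intros H z Hz.
  (* Where |psi(z)| = 1, the case in which the quotient counts as infinite, the kernel at psi(z) is
     0 and [Q] holds directly. *)
  - destruct (Rle_lt_or_eq_dec _ _ (Hbd z Hz)) as [Hlt | Heq].
    + now apply julia_quotient_le, H.
    + rewrite (re_cayley (psi z)), Heq by auto.
      replace ((1 - 1 ^ 2) / Cmod (1 - psi z) ^ 2) with 0 by (unfold Rdiv; ring).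
      left. now apply re_cayley_pos.
  - intros Hlt. apply julia_quotient_le; auto. }
assert (H23 : P2 -> P3).
{ intros H. apply H2 in H.
  destruct (cayley_comp_affine psi Hhol Hbd Hn H) as [a [b [Hb E]]].
  exists a, b. split; [exact Hb|]. intros alpha beta z Hz.
  apply (mobius_cayley a b z (psi z)); auto. apply Hb. }
assert (H34 : P3 -> P4).
{ intros [a [b [Hb E]]]. apply (affine_const_or_automorphism psi a b Hhol Hbd Hb).
  intros z Hz. apply (mobius_cayley a b z (psi z)); [apply Hb|exact Hz|]. now apply E. }
assert (H42 : P4 -> P2).
{ intros [[theta [_ E]] | [[_ [Hd _]] H]] z Hz Hlt.
  (* A unimodular constant never satisfies |psi(z)| < 1, so (2) holds vacuously. *)
  - exfalso. assert (HC := Cmod_sqr (psi z)). rewrite E in HC, Hlt by exact Hz.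
    simpl fst in HC; simpl snd in HC.
    assert (HS := sin2_cos2 theta). unfold Rsqr in HS.
    generalize (Cmod_ge_0 (cos theta, sin theta)). nra.
  - apply julia_quotient_le; auto. apply stolz_stable_le; auto. }
tauto.
Qed.
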